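(* Let $0<\lambda<1$ and let $S$ be the nonsingular HK$(+1,\lambda)$ transformation on $(X,\mathcal B,\mu)$. There exist subsets $A$ and $B$ of $X$ of positive measure such that for all $n\in\mathbb Z$, $$(\mu\times\mu)\big((S\times S)^n(A\times A)\cap(A\times B)\big)=0.$$
   Context: The nonsingular HK$(+1,\lambda)$ transformation $(X,S,\mathcal B,\mu)$ is constructed by cutting and stacking. A column is a finite ordered collection $C_k=\{C_k(0),\dots,C_k(h_k-1)\}$ of pairwise disjoint intervals (levels); $h_k$ is its height. Start with $C_0=\{[0,1)\}$, $h_0=1$. Given $C_k$, cut each level $C_k(i)$ into a left subinterval $C_k(i)^{\mathrm{left}}$ and a right subinterval $C_k(i)^{\mathrm{right}}$ whose lengths satisfy $|C_k(i)^{\mathrm{right}}|=\lambda\,|C_k(i)^{\mathrm{left}}|$. Stack the right subcolumn on top of the left subcolumn, and put $2h_k+1$ new disjoint intervals (spacers) of positive finite length on top; that is, $C_{k+1}(i)=C_k(i)^{\mathrm{left}}$ for $0\le i<h_k$, $C_{k+1}(i)=C_k(i-h_k)^{\mathrm{right}}$ for $h_k\le i<2h_k$, and $C_{k+1}(i)$ is a new spacer interval for $2h_k\le i<4h_k+1$; so $h_{k+1}=4h_k+1$. The maximum length of the levels of $C_k$ tends to $0$ as $k\to\infty$. The space $X$ is the union of all levels of all columns, $\mathcal B$ its Borel sets, $\mu$ is Lebesgue measure, and $S$ is the a.e. defined invertible map sending each level $C_k(i)$, $0\le i<h_k-1$, to $C_k(i+1)$ by the orientation-preserving affine bijection (these maps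 are consistent as $k$ grows). *)

(* Defs.v *)
From mathcomp Require Import all_boot all_order all_algebra.
From mathcomp Require Import all_classical all_reals all_analysis.
Import Order.TTheory GRing.Theory Num.Theory.
Import numFieldNormedType.Exports.

Set Implicit Arguments.
Unset Strict Implicit.
Unset Printing Implicit Defensive.

Local Open Scope classical_set_scope.
Local Open Scope ring_scope.

(* A level is represented by the pair (a, b) of its endpoints and stands for
   the interval [a, b[; a column is the sequence of its levels, bottom first. *)
Section HK.
Variable R : realType.

Definition interval_of (J : R * R) : set R := `[J.1, J.2[.

Definition len (J : R * R) : R := J.2 - J.1.

(* The unique point c of J such that J.2 - c = lambda * (c - J.1). *)
Definition cut_point (lambda : R) (J : R * R) : R := J.1 + len J / (1 + lambda).

Definition left_part (lambda : R) (J : R * R) : R * R :=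
  (J.1, cut_point lambda J).

Definition right_part (lambda : R) (J : R * R) : R * R :=
  (cut_point lambda J, J.2).

(* sp k lists the spacers put on top when passing from C_k to C_(k+1). *)
Fixpoint column (lambda : R) (sp : nat -> seq (R * R)) (k : nat) :
    seq (R * R) :=
  if k is k'.+1 then
    let C := column lambda sp k' in
    map (left_part lambda) C ++ map (right_part lambda) C ++ sp k'
  else [:: (0, 1)].

Definition height lambda sp k : nat := size (column lambda sp k).

Definition level lambda sp k i : R * R := nth (0, 0) (column lambda sp k) i.

Record HK_spacers (lambda : R) (sp : nat -> seq (R * R)) : Prop := {
  HK_size : forall k, size (sp k) = (2 * height lambda sp k + 1)%N ;
  HK_pos : forall k J, J \in sp k -> J.1 < J.2 ;
  HK_disjoint : forall k i j, (i < j < height lambda sp k)%N ->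
    interval_of (level lambda sp k i) `&` interval_of (level lambda sp k j)
      = set0 ;
  HK_maxlen :
    (fun k => \big[Num.max/0]_(J <- column lambda sp k) len J) @ \oo --> (0 : R)
}.

Definition HK_space lambda sp : set R :=
  [set x | exists k i,
    (i < height lambda sp k)%N /\ interval_of (level lambda sp k i) x].

(* The increasing affine bijection from the interval J onto the interval K. *)
Definition affine_map (J K : R * R) (x : R) : R :=
  K.1 + (x - J.1) * (len K / len J).

(* The top level of C_k is cut into non-top levels of C_(k+1), so this
   determines S at every point of HK_space (its values elsewhere are
   irrelevant), with values in HK_space. The inverse is undefined only at 0,
   the common point of the bottom levels. *)
Definition is_HK_map (lambda : R) (sp : nat -> seq (R * R)) (S : R -> R) :=
  forall k i x, (i.+1 < height lambda sp k)%N ->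
    interval_of (level lambda sp k i) x ->
    S x = affine_map (level lambda sp k i) (level lambda sp k i.+1) x.

End HK.

Definition prod_map (T : Type) (S : T -> T) (p : T * T) : T * T :=
  (S p.1, S p.2).

(* f^n(E) for an invertible partially defined f on Y: for n < 0 it is the set
   of the points of Y that f^(-n) sends into E. *)
Definition zpow_image (T : Type) (Y : set T) (f : T -> T) (n : int)
    (E : set T) : set T :=
  match n with
  | Posz m => iter m f @` E
  | Negz m => Y `&` iter m.+1 f @^-1` E
  end.

(* Main.v *)
Require Import Defs.
From mathcomp Require Import all_boot all_order all_algebra.
From mathcomp Require Import all_classical all_reals all_analysis.
From mathcomp Require Import zify lra.
Import Order.TTheory GRing.Theory Num.Theory.
Import numFieldNormedType.Exports.

Local Open Scope classical_set_scope.
Local Open Scope ring_scope.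

(** Take for A and B the two lowest levels of C_1. A point of C_m(i) has in C_k
    a position i + (a sum of distinct h_s, m <= s < k), so the times at which
    C_m(i) meets C_m(j) are of the form j - i + sum_(s >= m) e_s h_s with e_s in
    {-1,0,1}. If n moved A to A and A to B at once, then 1 would be of the form
    sum_(s >= 1) c_s h_s with |c_s| <= 2; but h_(s+1) > 4 h_s makes every nonzero
    such sum at least h_1 = 5 in absolute value. So every intersection is even
    empty. *)

Lemma interval_ofE {R : realType} (J : R * R) (x : R) :
  interval_of J x <-> J.1 <= x < J.2.
Proof. by rewrite /interval_of /= in_itv. Qed.

Lemma cut_point_between {R : realType} {lambda : R} {J : R * R} :
  0 < lambda -> J.1 < J.2 -> J.1 < cut_point lambda J < J.2.
Proof.
move=> l0 J12; have l1 : 0 < 1 + lambda by lra.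
have len0 : 0 < len J by rewrite /len; lra.
rewrite /cut_point ltrDl divr_gt0//=.
suff : len J / (1 + lambda) < len J by rewrite {2}/len; lra.
by rewrite ltr_pdivrMr// mulrDr mulr1 ltrDl mulr_gt0.
Qed.

Lemma interval_of_cut {R : realType} (lambda : R) {J : R * R} {x : R} :
  interval_of J x ->
  interval_of (left_part lambda J) x \/ interval_of (right_part lambda J) x.
Proof.
rewrite !interval_ofE/= => /andP[-> ->].
by case: (ltP x (cut_point lambda J)); [left|right].
Qed.

Lemma affine_map_interval_of {R : realType} {J K : R * R} {x : R} :
  K.1 < K.2 -> interval_of J x -> interval_of K (affine_map J K x).
Proof.
rewrite !interval_ofE /affine_map /len => K12 /andP[J1x xJ2].
have J0 : 0 < J.2 - J.1 by lra.
rewrite lerDl mulr_ge0 ?divr_ge0//=; [|lra..].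
rewrite -ltrBrDl mulrCA gtr_pMr; last lra.
by rewrite ltr_pdivrMr// mul1r; lra.
Qed.

Lemma iter_prod_map {T : Type} (f : T -> T) (n : nat) (p : T * T) :
  iter n (prod_map f) p = (iter n f p.1, iter n f p.2).
Proof. by elim: n => [|n IH]; [case: p|rewrite iterS IH]. Qed.

Section HKColumns.
Set Implicit Arguments.
Unset Strict Implicit.
Context {R : realType} (lambda : R) (sp : nat -> seq (R * R)) (S : R -> R).
Hypothesis lambda_gt0 : 0 < lambda.
Hypothesis HK : HK_spacers lambda sp.
Hypothesis HKS : is_HK_map lambda sp S.

Local Notation h := (height lambda sp).
Local Notation C := (level lambda sp).

Lemma heightS k : h k.+1 = (4 * h k + 1)%N.
Proof.
rewrite {1}/height /= !size_cat !size_map (HK_size HK) -/(height _ _ _); lia.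
Qed.

(** This crude growth bound is what provides room for any prescribed number of steps of [S]. *)
Lemma ltn_height k : (k < h k)%N.
Proof. by elim: k => // k IH; rewrite heightS; lia. Qed.

Lemma leq_height m k : (m <= k)%N -> (h m <= h k)%N.
Proof.
elim: k => [|k IH]; first by rewrite leqn0 => /eqP ->.
by rewrite leq_eqVlt => /predU1P[->//|/IH]; rewrite heightS; lia.
Qed.

Lemma column_pos k J : J \in column lambda sp k -> J.1 < J.2.
Proof.
elim: k J => [|k IH] J /=; first by rewrite inE => /eqP -> /=.
rewrite !mem_cat => /or3P[/mapP[I /IH I12 ->]|/mapP[I /IH I12 ->]|].
- by have /andP[] := cut_point_between lambda_gt0 I12.
- by have /andP[] := cut_point_between lambda_gt0 I12.
- exact: HK_pos HK _ _.
Qed.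

Lemma level_left k i :
  (i < h k)%N -> C k.+1 i = left_part lambda (C k i).
Proof. by move=> ik; rewrite /level nth_cat size_map ik (nth_map (0, 0)). Qed.

Lemma level_right k i :
  (i < h k)%N -> C k.+1 (h k + i)%N = right_part lambda (C k i).
Proof.
move=> ik; rewrite /level nth_cat size_map ltnNge leq_addr/= addKn.
by rewrite nth_cat size_map ik (nth_map (0, 0)).
Qed.

(** The bit [b] tells whether [x] falls in the left half ([0]) or the right half ([1]) of its level.
    The bound records that the new position is below the spacers. *)
Lemma level_refine k i x : (i < h k)%N -> interval_of (C k i) x ->
  exists2 b : bool, interval_of (C k.+1 (b * h k + i)%N) x
    & (b * h k + i < 2 * h k)%N.
Proof.
move=> ik /(interval_of_cut lambda)[]; rewrite -?level_left -?level_right// => Cx.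
- by exists false => //; lia.
- by exists true; rewrite mul1n//; lia.
Qed.

Lemma level_inj k i j x : (i < h k)%N -> (j < h k)%N ->
  interval_of (C k i) x -> interval_of (C k j) x -> i = j.
Proof.
wlog ij : i j / (i <= j)%N.
  by move=> W; case: (leqP i j) => [|/ltnW] ? ? ? ? ?; [|symmetry]; exact: W.
move=> _ jk Cix Cjx; move: ij; rewrite leq_eqVlt => /predU1P[//|ij].
have ijk : (i < j < h k)%N by rewrite ij.
have : (interval_of (C k i) `&` interval_of (C k j)) x by [].
by rewrite (HK_disjoint HK ijk).
Qed.

Lemma iter_level k i n x : (i + n < h k)%N ->
  interval_of (C k i) x -> interval_of (C k (i + n)%N) (iter n S x).
Proof.
elim: n => [|n IH] ink Cix; first by rewrite addn0.
have Cx : interval_of (C k (i + n)%N) (iter n S x) by apply: IH => //; lia.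
rewrite iterS addnS in ink *; rewrite (HKS ink Cx).
by apply: affine_map_interval_of => //; apply: (@column_pos k); exact: mem_nth.
Qed.

(* The last bound leaves room above the positions for arbitrarily many steps of
   S; the two before it hold because the four positions of column k + m differ
   from those of column m by sums of distinct heights. *)
Lemma positions_refine m i i' j j' x x' y y' k :
  (i < h m)%N -> (i' < h m)%N -> (j < h m)%N -> (j' < h m)%N ->
  interval_of (C m i) x -> interval_of (C m i') x' ->
  interval_of (C m j) y -> interval_of (C m j') y' ->
  exists p p' q q' : nat, let l := (k + m)%N in
    let z : int := (p%:Z + q'%:Z - p'%:Z - q%:Z)
                 - (i%:Z + j'%:Z - i'%:Z - j%:Z) in
    [/\ [/\ interval_of (C l p) x, interval_of (C l p') x',
            interval_of (C l q) y & interval_of (C l q') y'],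
        [/\ (p < h l)%N, (p' < h l)%N, (q < h l)%N & (q' < h l)%N],
        `|z| <= (h l)%:Z - (h m)%:Z,
        z = 0 \/ (h m)%:Z <= `|z| &
        (0 < k)%N -> (p + k <= h l)%N /\ (q + k <= h l)%N].
Proof.
move=> im i'm jm j'm Cx Cx' Cy Cy'; elim: k => [|k].
  by exists i, i', j, j'; rewrite /= add0n !subrr; split => //; left.
move=> [p [p' [q [q' /= [[px p'x' qy q'y'] [pl p'l ql q'l] zl zm _]]]]].
(* Each position grows by [0] or [h (k + m)], so [z] changes by [b + c' - b' - c], which lies in
   [-2, 2], times [h (k + m)]. *)
have [b Cb bl] := level_refine pl px.
have [b' Cb' b'l] := level_refine p'l p'x'.
have [c Cc cl] := level_refine ql qy.
have [c' Cc' c'l] := level_refine q'l q'y'.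
exists (b * h (k + m) + p)%N, (b' * h (k + m) + p')%N.
exists (c * h (k + m) + q)%N, (c' * h (k + m) + q')%N.
have kl := ltn_height (k + m); have ml := leq_height (leq_addl k m).
rewrite addSn /=; split; first by split.
- by rewrite heightS; split; lia.
(* The new [z] is at most 3 [h (k + m)] - [h m] in absolute value, which the factor 4 in [heightS]
   absorbs. *)
- by rewrite heightS; move: b b' c c' {Cb Cb' Cc Cc' bl b'l cl c'l} => [] [] [] [];
    rewrite ?mul1n ?mul0n; lia.
(* If the coefficient vanishes, [z] is unchanged. Otherwise the added term is at least [h (k + m)]
   in absolute value, and the old [z] cancels at most [h (k + m)] - [h m] of it. *)
- by move: b b' c c' {Cb Cb' Cc Cc' bl b'l cl c'l} => [] [] [] [];
    rewrite ?mul1n ?mul0n; lia.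
(* New positions are below 2 [h (k + m)], and [k < h (k + m)], so the spacers leave room for [k.+1]
   steps. *)
- by rewrite heightS; lia.
Qed.

(** In a tall enough column both points climb exactly [n] levels, so [p + q' - p' - q] is 0 and [z]
    is [i' + j - i - j']. The last two hypotheses put this strictly between -[h m] and [h m], which
    forces it to be 0. *)
Lemma level_shift_rigid m i i' j j' n x y :
  (i < h m)%N -> (i' < h m)%N -> (j < h m)%N -> (j' < h m)%N ->
  interval_of (C m i) x -> interval_of (C m i') (iter n S x) ->
  interval_of (C m j) y -> interval_of (C m j') (iter n S y) ->
  (i + j' < i' + j + h m)%N -> (i' + j < i + j' + h m)%N ->
  (i + j' = i' + j)%N.
Proof.
move=> im i'm jm j'm Cx Cx' Cy Cy' close1 close2.
(* Taking [n.+1] refinements rather than [n] makes [p + n] and [q + n] strictly smaller than the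
   height. *)
have [p [p' [q [q' /= [[px p'x qy q'y] [pl p'l ql q'l] _ zm]]]]] :=
  positions_refine n.+1 im i'm jm j'm Cx Cx' Cy Cy'.
move=> /(_ isT)[pn qn].
have pnl : (p + n < h (n.+1 + m))%N by lia.
have qnl : (q + n < h (n.+1 + m))%N by lia.
have := level_inj pnl p'l (iter_level pnl px) p'x.
have := level_inj qnl q'l (iter_level qnl qy) q'y.
lia.
Qed.

End HKColumns.

Theorem theorem4p2 (R : realType) (lambda : R) (sp : nat -> seq (R * R))
    (S : R -> R) :
  0 < lambda < 1 ->
  HK_spacers lambda sp ->
  is_HK_map lambda sp S ->
  let X := HK_space lambda sp in
  let mu := @lebesgue_measure R in
  exists A B : set (measurableTypeR R),
    [/\ measurable A, A `<=` X & (0 < mu A)%E] /\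
    [/\ measurable B, B `<=` X & (0 < mu B)%E] /\
    forall n : int,
      let E := zpow_image (X `*` X) (prod_map S) n (A `*` A) `&` (A `*` B) in
      measurable (E : set (measurableTypeR R * measurableTypeR R)) /\
      (mu \x mu)%E E = 0%E.
Proof.
move=> /andP[l0 _] HK HKS X mu.
have h1 : height lambda sp 1 = 5%N by rewrite heightS.
pose C1 i : set (measurableTypeR R) := interval_of (level lambda sp 1 i).
have C1P i : (i < 5)%N -> [/\ measurable (C1 i), C1 i `<=` X & (0 < mu (C1 i))%E].
  move=> i5; split; first exact: measurable_itv.
    by move=> x C1x; exists 1%N, i; rewrite h1.
  have C1i : (level lambda sp 1 i).1 < (level lambda sp 1 i).2.
    apply: (column_pos l0 HK (k := 1)); apply: mem_nth.
    by rewrite -/(height lambda sp 1) h1.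
  by rewrite /mu /C1 /interval_of lebesgue_measure_itv/= lte_fin C1i lte_fin subr_gt0.
(* Indices in {0, 1} give displacements that differ by at most 2, less than the height 5. *)
have C1_rigid i i' j j' n x y : (i < 2)%N -> (i' < 2)%N -> (j < 2)%N -> (j' < 2)%N ->
    C1 i x -> C1 i' (iter n S x) -> C1 j y -> C1 j' (iter n S y) ->
    (i + j' = i' + j)%N.
  move=> i2 i'2 j2 j'2 Cx Cx' Cy Cy'.
  by apply: (level_shift_rigid l0 HK HKS (m := 1) (n := n) (x := x) (y := y)); rewrite ?h1 //; lia.
exists (C1 0%N), (C1 1%N); split; first exact: C1P.
split; first exact: C1P.
move=> n E; suff -> : E = set0 by rewrite measure0.
rewrite -subset0 => -[x y] [+ [/= Ax By]]; case: n @E => n _.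
  (* For n >= 0, the same iterate would displace [u] by 0 levels and [v] by 1. *)
  move=> [[u v] [/= Au Av]]; rewrite iter_prod_map => -[/= ux vy].
  rewrite -ux in Ax; rewrite -vy in By.
  by have := C1_rigid 0%N 0%N 0%N 1%N n u v isT isT isT isT Au Ax Av By.
(* [Negz n] stands for -(n + 1): here [n.+1] forward steps would displace [x] by 0 levels and [y] by
   -1. *)
move=> [_]; rewrite /preimage /mkset iter_prod_map => -[Ax' Ay'].
by have := C1_rigid 0%N 0%N 1%N 0%N n.+1 x y isT isT isT isT Ax Ax' By Ay'.
Qed.
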